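(* Let $f(n)$ denote the number of Wilf partitions of the positive integer $n$, and let $F(n)$ denote the number of Wilf partitions of $n$ that are fixed points of the involution $\iota$ (defined in the context). Then, as $n \to \infty$, $$\log F(n) \sim \frac12 \log f(n) \sim \frac16 (6n)^{1/3} \log n.$$
   Context: A Wilf partition of a positive integer $n$ is an integer partition of $n$ in which all nonzero multiplicities are distinct. Writing a partition as the set of its part–multiplicity pairs $(p_i,m_i)$ (meaning the part $p_i$ occurs exactly $m_i\ge 1$ times, the $p_i$ being distinct), a Wilf partition has distinct $p_i$ and distinct $m_i$. The involution $\iota$ on Wilf partitions of $n$ interchanges part sizes and multiplicities: it sends the partition with pairs $\{(p_i,m_i)\}$ to the partition with pairs $\{(m_i,p_i)\}$ (which is again a Wilf partition of $n$ since $\sum p_i m_i = n$). A fixed point of $\iota$ is a Wilf partition such that whenever $(p,m)$ is one of its part–multiplicity pairs, so is $(m,p)$. Here $a(n)\sim b(n)$ means $a(n)/b(n)\to 1$. *)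

(* Defs.v *)
From mathcomp Require Import all_boot.
Set Implicit Arguments. Unset Strict Implicit. Unset Printing Implicit Defensive.

(* A candidate part-multiplicity pair for partitions of n: parts and multiplicities
   of a partition of n are at most n, so they live in 'I_n.+1. *)
Definition pm (n : nat) : finType := ('I_n.+1 * 'I_n.+1)%type.

(* S is the set of part-multiplicity pairs (p, m) of a Wilf partition of n:
   p, m >= 1, the parts are distinct, the multiplicities are distinct, and
   sum p*m = n. *)
Definition is_wilf (n : nat) (S : {set pm n}) : bool :=
  [&& [forall x in S, (0 < x.1) && (0 < x.2)],
      [forall x in S, forall y in S, (x.1 == y.1 :> nat) ==> (x == y)],
      [forall x in S, forall y in S, (x.2 == y.2 :> nat) ==> (x == y)]
    & (\sum_(x in S) (x.1 * x.2) == n)].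

Definition iota_fixed (n : nat) (S : {set pm n}) : bool :=
  [forall x in S, ((x.2, x.1) : pm n) \in S].

Definition wilf_count (n : nat) : nat := #|[set S : {set pm n} | is_wilf S]|.

Definition wilf_fixed_count (n : nat) : nat :=
  #|[set S : {set pm n} | is_wilf S && iota_fixed S]|.

(* Main.v *)
(** A Wilf partition of [n] with [k] distinct part sizes satisfies [k ^ 3 <= 6 n],
    since pairing the [k] smallest parts with the [k] smallest multiplicities in
    opposite order minimises the sum.

    Upper bounds: in the product over pairs [(p, m)] of
    [1 + z * exp (- t * p * m)], each Wilf partition of [n] contributes at least
    [z ^ k * exp (- t * n)], while the product is at most
    [exp (z * (1 + ln n) / t)].  With [w = n ^ (1/3)], [t = 1 / w ^ 2] and
    [z = 1 / (w * (1 + ln n))] this leaves [k * ln n / 3] as the main term.  A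
    fixed point is determined by its pairs with [p <= m], which gives each pair
    of conjugate pairs the weight of a single one and halves the main term.

    Lower bounds: cut an interval of [2 h b] integers into [2 h] blocks of
    length [b] and match the block [i] with the block [2 h - 1 - i] by arbitrary
    bijections.  For fixed [h] and large [b] the sum of products is close to its
    minimum, so [b] can be taken close to [(6 n) ^ (1/3) / (2 h)].  The blocks
    [i < h] give [b! ^ h] choices; the other half is their mirror image for a
    fixed point and is chosen independently in general.  The small numbers [1]
    and [3], kept out of the blocks, serve to make the total exactly [n]. *)
From Stdlib Require Import Reals Lra.
From Coquelicot Require Import Coquelicot.
From mathcomp Require Import all_boot perm.
From mathcomp Require Import zify Rstruct.
Require Import Defs.
Set Implicit Arguments. Unset Strict Implicit. Unset Printing Implicit Defensive.

Local Open Scope nat_scope.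

(** * The number of distinct parts *)

Section DistinctLabels.
Variable T : finType.
Implicit Types (S : {set T}) (f g : T -> nat).

(** The labels are positive and distinct, so at most [a] elements carry one of [1, ..., a]. *)
Lemma card_gt_label S f a :
  {in S &, injective f} -> {in S, forall x, 0 < f x} ->
  #|S| - a <= #|[set x in S | a < f x]|.
Proof.
move=> injf f0; rewrite leq_subLR.
have -> : #|S| = #|[set x in S | f x <= a]| + #|[set x in S | a < f x]|.
  rewrite -[LHS](cardsID [set x | f x <= a]).
  by congr (_ + _); apply: eq_card => x; rewrite !inE // -ltnNge andbC.
rewrite leq_add2r cardE -(size_map f) -{2}(size_iota 1 a).
apply: uniq_leq_size.
  rewrite map_inj_in_uniq ?enum_uniq // => x y; rewrite !mem_enum !inE.
  by case/andP=> xS _ /andP[yS _]; apply: injf.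
move=> _ /mapP[x + ->]; rewrite mem_enum inE mem_iota => /andP[xS fx].
by rewrite f0 //= add1n ltnS.
Qed.

(* Layer cake: [f x] counts the [a] with [a < f x]. *)
Lemma layer_sum_le S f g k :
  \sum_(a < k) \sum_(x in [set x in S | a < f x]) g x <= \sum_(x in S) f x * g x.
Proof.
have -> : \sum_(a < k) \sum_(x in [set x in S | a < f x]) g x
        = \sum_(a < k) \sum_(x in S | a < f x) g x.
  by apply: eq_bigr => a _; apply: eq_bigl => x; rewrite inE.
rewrite (exchange_big_dep (mem S)) /= => [|a x _ /andP[]//].
apply: leq_sum => x xS.
rewrite sum_nat_const leq_mul2r; apply/orP; right.
rewrite cardE -(size_map val) -{2}(size_iota 0 (f x)).
apply: uniq_leq_size; first by rewrite map_inj_uniq ?enum_uniq //; apply: val_inj.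
by move=> _ /mapP[a + ->]; rewrite mem_enum mem_iota unfold_in => /andP[_].
Qed.

(** Layer cake with weight [1]: layer [a] has at least [#|S| - a] elements, and
    [k + (k - 1) + ... + 1] is at least [k ^ 2 / 2]. *)
Lemma sqr_card_le_sum S f :
  {in S &, injective f} -> {in S, forall x, 0 < f x} ->
  #|S| ^ 2 <= 2 * \sum_(x in S) f x.
Proof.
move=> injf f0.
have sumB k : k ^ 2 <= 2 * \sum_(a < k) (k - a).
  elim: k => [|k IHk]; first by rewrite big_ord0.
  rewrite big_ord_recl subn0; under eq_bigr do rewrite lift0 subSS.
  by move: IHk; rewrite !expnS !expn0; set t := \sum_(i < k) _; lia.
apply: leq_trans (sumB _) _; rewrite leq_mul2l /=.
under [leqRHS]eq_bigr do rewrite -[f _]muln1.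
apply: leq_trans (layer_sum_le _ _ _ #|S|).
by apply: leq_sum => a _; rewrite sum1_card card_gt_label.
Qed.

(** Slicing by [f] and applying the square bound for [g] to each layer replaces sorting and the
    rearrangement inequality. The constant is [6 = 3 * 2]: the factor [3] from the sum of squares,
    the factor [2] from the square bound. *)
Lemma cube_card_le_sum S f g :
  {in S &, injective f} -> {in S &, injective g} ->
  {in S, forall x, 0 < f x} -> {in S, forall x, 0 < g x} ->
  #|S| ^ 3 <= 6 * \sum_(x in S) f x * g x.
Proof.
move=> injf injg f0 g0.
have sumB k : k ^ 3 <= 3 * \sum_(a < k) (k - a) ^ 2.
  elim: k => [|k IHk]; first by rewrite big_ord0.
  rewrite big_ord_recl subn0; under eq_bigr do rewrite lift0 subSS.
  by move: IHk; rewrite !expnS !expn0; set t := \sum_(i < k) _; lia.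
apply: leq_trans (sumB _) _; rewrite -[6]/(3 * 2) -mulnA leq_mul2l /=.
apply: (@leq_trans (2 * \sum_(a < #|S|) \sum_(x in [set x in S | a < f x]) g x));
  last by rewrite leq_mul2l layer_sum_le.
rewrite big_distrr; apply: leq_sum => a _.
have sub x : x \in [set x in S | a < f x] -> x \in S by rewrite inE => /andP[].
apply: leq_trans (sqr_card_le_sum _ _).
- by rewrite leq_sqr card_gt_label.
- by move=> x y /sub xS /sub yS; apply: injg.
- by move=> x /sub; apply: g0.
Qed.

End DistinctLabels.

(** * Wilf partitions and fixed points as sets of pairs *)

Lemma wilfP n (S : {set pm n}) :
  reflect [/\ {in S, forall x : pm n, 0 < x.1 /\ 0 < x.2},
              {in S &, injective (fun x : pm n => x.1 : nat)},
              {in S &, injective (fun x : pm n => x.2 : nat)}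
            & \sum_(x in S) x.1 * x.2 = n] (is_wilf S).
Proof.
apply: (iffP and4P) => [[pos inj1 inj2 /eqP sumS]|[pos inj1 inj2 sumS]].
  split=> // [x xS|x y xS yS xy|x y xS yS xy].
  - by apply/andP; apply: (forall_inP pos).
  - have /forall_inP /(_ _ yS) /implyP h := forall_inP inj1 _ xS.
    by apply/eqP/h/eqP.
  - have /forall_inP /(_ _ yS) /implyP h := forall_inP inj2 _ xS.
    by apply/eqP/h/eqP.
split; last exact/eqP.
- by apply/forall_inP=> x /pos[-> ->].
- apply/forall_inP=> x xS; apply/forall_inP=> y yS.
  by apply/implyP=> /eqP xy; apply/eqP/inj1.
- apply/forall_inP=> x xS; apply/forall_inP=> y yS.
  by apply/implyP=> /eqP xy; apply/eqP/inj2.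
Qed.

Lemma wilf_cube_card_le n (S : {set pm n}) : is_wilf S -> #|S| ^ 3 <= 6 * n.
Proof.
case/wilfP=> pos inj1 inj2 sumS.
have := cube_card_le_sum inj1 inj2 (fun x xS => (pos x xS).1)
  (fun x xS => (pos x xS).2).
by rewrite sumS.
Qed.

(** Swapping coordinates matches the pairs below the diagonal with those strictly above it, so
    off-diagonal pairs count twice. It serves both for the total [n] and for the number of pairs. *)
Lemma sum_fixed n (S : {set pm n}) (g : pm n -> nat) :
  iota_fixed S -> (forall x, g (x.2, x.1) = g x) ->
  \sum_(x in S) g x
    = \sum_(x in S | x.1 <= x.2) (if x.1 == x.2 then 1 else 2) * g x.
Proof.
move=> /forall_inP fixS gsym.
have swapS x : ((x.2, x.1) \in S) = (x \in S).
  by apply/idP/idP=> [/fixS /=|/fixS //]; case: x.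
rewrite (bigID (fun x : pm n => x.1 <= x.2)) /=.
have -> : \sum_(x in S | ~~ (x.1 <= x.2)) g x
        = \sum_(x in S | x.1 <= x.2) (if x.1 != x.2 then g x else 0).
  rewrite (reindex_inj (h := fun x : pm n => (x.2, x.1))) /=; last first.
    by move=> [a b] [c d] [-> ->].
  rewrite -[RHS]big_mkcondr /=.
  apply: eq_big => [x|x _]; last exact: gsym.
  by rewrite swapS -ltnNge ltn_neqAle -val_eqE /= -andbA [(_ != _) && _]andbC.
rewrite -big_split /=; apply: eq_bigr => x _.
by case: eqP => _; rewrite ?mul1n ?addn0 // mul2n addnn.
Qed.

(** The pairs with [x.1 > x.2] are mirror images, so fixed points may be counted by their upper
    halves. *)
Lemma fixed_upper_inj n (S1 S2 : {set pm n}) :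
  iota_fixed S1 -> iota_fixed S2 ->
  [set x in S1 | x.1 <= x.2] = [set x in S2 | x.1 <= x.2] -> S1 = S2.
Proof.
have swapS (S : {set pm n}) x : iota_fixed S -> ((x.2, x.1) \in S) = (x \in S).
  move=> /forall_inP fixS.
  by apply/idP/idP=> [/fixS /=|/fixS //]; case: x.
move=> fix1 fix2 /setP eqU; apply/setP=> x.
have [le12|lt21] := leqP x.1 x.2.
  by have := eqU x; rewrite !inE le12 !andbT.
by have := eqU (x.2, x.1); rewrite !inE /= (ltnW lt21) !andbT !swapS.
Qed.

(** * Construction of many Wilf partitions *)

Lemma unzip1_inj_in (s : seq (nat * nat)) :
  uniq (unzip1 s) -> {in s &, injective fst}.
Proof.
elim: s => [|z s IHs] //= /andP[zs us] x y.
rewrite !inE => /orP[/eqP->|xs] /orP[/eqP->|ys] // xy; last exact: IHs.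
- by rewrite xy map_f in zs.
- by rewrite -xy map_f in zs.
Qed.

Lemma unzip2_inj_in (s : seq (nat * nat)) :
  uniq (unzip2 s) -> {in s &, injective snd}.
Proof.
elim: s => [|z s IHs] //= /andP[zs us] x y.
rewrite !inE => /orP[/eqP->|xs] /orP[/eqP->|ys] // xy; last exact: IHs.
- by rewrite xy map_f in zs.
- by rewrite -xy map_f in zs.
Qed.

(** Explicit partitions are easier to write as lists over [nat]: the bounds required by ['I_n.+1]
    then follow from the total being [n]. *)
Definition wilf_seq n (s : seq (nat * nat)) : bool :=
  [&& all (fun z => (0 < z.1) && (0 < z.2)) s, uniq (unzip1 s), uniq (unzip2 s)
    & \sum_(z <- s) z.1 * z.2 == n].

Definition pair_set n (s : seq (nat * nat)) : {set pm n} :=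
  [set x : pm n | (x.1 : nat, x.2 : nat) \in s].

Lemma wilf_seq_bound n s z :
  wilf_seq n s -> z \in s -> z.1 < n.+1 /\ z.2 < n.+1.
Proof.
case/and4P=> /allP pos _ _ /eqP sumS zs; have /andP[z1 z2] := pos _ zs.
by move: sumS; rewrite (big_rem z) //= => sumS; split; nia.
Qed.

Lemma wilf_seq_mem n s z :
  wilf_seq n s -> z \in s -> (inord z.1, inord z.2) \in pair_set n s.
Proof.
move=> ws zs; have [z1 z2] := wilf_seq_bound ws zs.
by rewrite inE /= !inordK // -surjective_pairing.
Qed.

Lemma pair_set_wilf n s : wilf_seq n s -> is_wilf (pair_set n s).
Proof.
move=> ws; case/and4P: (ws) => /allP pos u1 u2 /eqP sumS.
apply/wilfP; split.
- by move=> x; rewrite inE => /pos /andP.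
- move=> [x1 x2] [y1 y2]; rewrite !inE /= => xs ys xy.
  by case: (unzip1_inj_in u1 xs ys xy) => /val_inj -> /val_inj ->.
- move=> [x1 x2] [y1 y2]; rewrite !inE /= => xs ys xy.
  by case: (unzip2_inj_in u2 xs ys xy) => /val_inj -> /val_inj ->.
pose emb (z : nat * nat) : pm n := (inord z.1, inord z.2).
have embK z : z \in s -> ((emb z).1 : nat, (emb z).2 : nat) = z.
  move=> zs; have [z1 z2] := wilf_seq_bound ws zs.
  by rewrite /emb /= !inordK // -surjective_pairing.
have uemb : uniq (map emb s).
  rewrite map_inj_in_uniq; first exact: map_uniq u1.
  by move=> y z ys zs eyz; rewrite -(embK _ ys) eyz embK.
rewrite -[RHS]sumS.
transitivity (\sum_(x <- map emb s) x.1 * x.2).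
  rewrite big_uniq //=; apply: eq_bigl => x; rewrite inE.
  apply/idP/mapP=> [xs|[z zs ->]]; last by rewrite embK.
  by exists (val x.1, val x.2); rewrite // /emb /= !inord_val; case: (x).
rewrite big_map big_seq [RHS]big_seq; apply: eq_bigr => z /embK.
by case: z => z1 z2 [-> ->].
Qed.

Lemma pair_set_fixed n s :
  {in s, forall z, (z.2, z.1) \in s} -> iota_fixed (pair_set n s).
Proof. by move=> swap_s; apply/forall_inP=> x; rewrite !inE => /swap_s. Qed.

Lemma pair_set_inj n s1 s2 :
  wilf_seq n s1 -> wilf_seq n s2 -> pair_set n s1 = pair_set n s2 ->
  {subset s1 <= s2}.
Proof.
move=> w1 w2 eqs z zs; have := wilf_seq_mem w1 zs; rewrite eqs inE /=.
have [z1 z2] := wilf_seq_bound w1 zs.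
by rewrite !inordK // -surjective_pairing.
Qed.

(** * The block construction *)

Section Blocks.
Variables h b : nat.
Implicit Types (s t : {ffun 'I_h -> {perm 'I_b}}) (u : 'I_h * 'I_b).

(** The offset [4] keeps [1] and [3] available for correcting the total. *)
Definition low u := 4 + u.1 * b + u.2.
Definition high s u := 4 + (h.*2.-1 - u.1) * b + s u.1 u.2.
Definition blocks s := [seq (low u, high s u) | u <- enum {: 'I_h * 'I_b}].
Definition swapped s := [seq (high s u, low u) | u <- enum {: 'I_h * 'I_b}].
Definition weight s := \sum_u low u * high s u.

(** Euclidean division by [b] recovers the block and the position inside it. *)
Lemma low_inj : injective low.
Proof.
move=> [i j] [i' j']; rewrite /low /= -!addnA => /addnI eq_ij.
have := edivn_eq i (ltn_ord j); rewrite eq_ij (edivn_eq i' (ltn_ord j')).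
by case=> /val_inj -> /val_inj ->.
Qed.

Lemma high_inj s : injective (high s).
Proof.
move=> [i j] [i' j']; rewrite /high /= -!addnA => /addnI eq_ij.
have := edivn_eq (h.*2.-1 - i) (ltn_ord (s i j)).
rewrite eq_ij (edivn_eq _ (ltn_ord (s i' j'))) => -[eqi /val_inj eqj].
have eqii : i = i'.
  by apply: val_inj => /=; have := ltn_ord i; have := ltn_ord i'; lia.
by move: eqj; rewrite eqii => /perm_inj ->.
Qed.

Lemma low_bounds u : 3 < low u < h * b + 4.
Proof.
case: u => i j; rewrite /low /=.
have := ltn_ord i; have := ltn_ord j; nia.
Qed.

Lemma high_bounds s u : h * b + 4 <= high s u < h.*2 * b + 4.
Proof.
case: u => i j; rewrite /high /=.
have := ltn_ord i; have := ltn_ord (s i j); move: (s i j : nat) => k kb ih.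
by apply/andP; split; nia.
Qed.

Lemma mem_blocks s u : (low u, high s u) \in blocks s.
Proof. by apply/mapP; exists u; rewrite ?mem_enum. Qed.

Lemma mem_swapped s u : (high s u, low u) \in swapped s.
Proof. by apply/mapP; exists u; rewrite ?mem_enum. Qed.

Lemma weight_blocks s : \sum_(z <- blocks s) z.1 * z.2 = weight s.
Proof. by rewrite big_map big_enum. Qed.

Lemma weight_swapped s : \sum_(z <- swapped s) z.1 * z.2 = weight s.
Proof. by rewrite big_map big_enum; apply: eq_bigr => u _; rewrite mulnC. Qed.

(** [low] stays below [h * b + 4] and [high] does not, so the two halves are disjoint. The range
    shows later that the correcting pairs collide with nothing. *)
Lemma blocks_unzip1 s t :
  [/\ uniq (unzip1 (blocks s ++ swapped t))
    & all (fun k => 3 < k < h.*2 * b + 4) (unzip1 (blocks s ++ swapped t))].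
Proof.
have -> : unzip1 (blocks s ++ swapped t)
    = map low (enum {: 'I_h * 'I_b}) ++ map (high t) (enum {: 'I_h * 'I_b}).
  by rewrite /unzip1 map_cat -!map_comp.
split.
  rewrite cat_uniq (map_inj_uniq low_inj) (map_inj_uniq (@high_inj t)) enum_uniq.
  rewrite andbT /=; apply/hasPn=> _ /mapP[u _ ->]; apply/mapP=> -[v _].
  have := low_bounds v; have := high_bounds t u; lia.
apply/allP=> k; rewrite mem_cat => /orP[] /mapP[u _ ->].
- have := low_bounds u; nia.
- have := high_bounds t u; lia.
Qed.

Lemma blocks_unzip2 s t :
  [/\ uniq (unzip2 (blocks s ++ swapped t))
    & all (fun k => 3 < k < h.*2 * b + 4) (unzip2 (blocks s ++ swapped t))].
Proof.
have -> : unzip2 (blocks s ++ swapped t)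
    = map (high s) (enum {: 'I_h * 'I_b}) ++ map low (enum {: 'I_h * 'I_b}).
  by rewrite /unzip2 map_cat -!map_comp.
(* Up to order, the multiplicities of [blocks s ++ swapped t] are the parts of
   [blocks s ++ swapped s]. *)
have := blocks_unzip1 s s; rewrite /unzip1 map_cat -!map_comp.
rewrite (perm_uniq (permEl (perm_catC _ _))).
by rewrite (perm_all _ (permEl (perm_catC _ _))).
Qed.

(** In block [i], [low] is at most [(i + 2) * b] and [high] at most [(2 h + 1 - i) * b], whatever
    the permutations. The sum of the products of these bounds has leading term [2 h ^ 3 / 3] times
    [b ^ 3], so the factor [12] yields the cube of [2 h b] to leading order. *)
Lemma weight_bound s : 4 <= b -> 12 * weight s <= (b * (h.*2 + 4)) ^ 3.
Proof.
move=> b4.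
(* Induction on [j] needs [c] fixed, although only [c = 2 h + 1], [j = h] is used. Negative terms of
   the closed form are moved to the left to avoid subtraction. *)
have sumB c j : j <= c ->
    6 * (\sum_(i < j) (i + 2) * (c - i)) + 2 * j ^ 3 + 3 * j ^ 2
      = 3 * c * j ^ 2 + 9 * c * j + 5 * j.
  rewrite !expnS !expn0; elim: j => [|j IHj] jc; first by rewrite big_ord0; lia.
  move: (IHj (ltnW jc)); rewrite big_ord_recr /=; set t := \sum_(i < j) _.
  by have [d ->] : exists d, c = j + d; [exists (c - j); lia | nia].
have le_weight : weight s <= b ^ 3 * \sum_(i < h) (i + 2) * (h.*2.+1 - i).
  rewrite /weight big_distrr.
  have -> : \sum_u low u * high s u = \sum_(i < h) \sum_(j < b) low (i, j) * high s (i, j).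
    by rewrite pair_bigA; apply: eq_bigr => -[].
  apply: leq_sum => i _.
  apply: (@leq_trans (\sum_(j < b) ((i + 2) * b) * ((h.*2.+1 - i) * b))).
    apply: leq_sum => j _; rewrite /low /high /=.
    have := ltn_ord i; have := ltn_ord j; have := ltn_ord (s i j).
    move: (s i j : nat) => k kb jb ih; apply: leq_mul; first by nia.
    have -> : h.*2.+1 - i = (h.*2.-1 - i) + 2 by lia.
    by rewrite mulnDl; lia.
  by rewrite sum_nat_const card_ord !expnS expn0 /=; lia.
have := sumB h.*2.+1 h; move: le_weight; set t := \sum_(i < h) _ => le_weight.
rewrite expnMn => /(_ ltac:(lia)) eqt.
apply: (@leq_trans (12 * (b ^ 3 * t))); first by rewrite leq_mul2l le_weight.
rewrite mulnCA leq_mul2l; apply/orP; right.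
by move: eqt; rewrite -mul2n !expnS !expn0; nia.
Qed.

Variable n : nat.
Hypotheses (b8 : 8 <= b) (room : (b * (h.*2 + 5)) ^ 3 <= 6 * n).

(** The step from [2 h + 4] to [2 h + 5] in [room] pays for the slack. It is large enough that even
    half of what is missing to [n] exceeds every number in the blocks. *)
Lemma weight_room s t : weight s + weight t + 2 * (h.*2 * b) + 30 <= n.
Proof.
have b4 : 4 <= b by lia.
have ws := weight_bound s b4; have wt := weight_bound t b4.
(* The left side is six times the slack [2 * (h.*2 * b) + 30]. *)
have big : 12 * (h.*2 * b) + 180 <= (b * (h.*2 + 5)) ^ 3 - (b * (h.*2 + 4)) ^ 3.
  rewrite !expnMn -mulnBr.
  have d : 2 * h + 5 <= (h.*2 + 5) ^ 3 - (h.*2 + 4) ^ 3.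
    by rewrite !expnS !expn0 -mul2n; nia.
  have b3 : 64 * b <= b ^ 3 by rewrite mulnC expnS leq_mul2l -[64]/(8 ^ 2) leq_sqr b8 orbT.
  apply: leq_trans (leq_mul b3 d); rewrite -mul2n.
  have -> : 64 * b * (2 * h + 5) = 128 * (h * b) + 320 * b by lia.
  by rewrite -[2 * h * b]mulnA; move: (h * b) => x; lia.
lia.
Qed.

(** The part [1] absorbs whatever is missing to [n]. *)
Definition wilf_of (st : {ffun 'I_h -> {perm 'I_b}} * {ffun 'I_h -> {perm 'I_b}}) :=
  (1, n - weight st.1 - weight st.2) :: (blocks st.1 ++ swapped st.2).

(* The weight of the symmetric block part is even, so [(3, 3)] fixes the parity. *)
Definition fixed_wilf_of s :=
  let X := n./2 - 4 * odd n - weight s in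
  nseq (odd n) (3, 3) ++ [:: (1, X); (X, 1)] ++ (blocks s ++ swapped s).

Lemma blocks_pos s t :
  all (fun z => (0 < z.1) && (0 < z.2)) (blocks s ++ swapped t).
Proof.
apply/allP=> z; rewrite mem_cat => /orP[] /mapP[u _ ->] /=.
- have := low_bounds u; have := high_bounds s u; lia.
- have := low_bounds u; have := high_bounds t u; lia.
Qed.

Lemma wilf_seq_of st : wilf_seq n (wilf_of st).
Proof.
case: st => s t; have := weight_room s t.
have [u1 a1] := blocks_unzip1 s t; have [u2 a2] := blocks_unzip2 s t => le_n.
apply/and4P; split.
- by rewrite /= blocks_pos andbT; lia.
- rewrite /= u1 andbT; apply/negP=> /(allP a1); lia.
- rewrite /= u2 andbT; apply/negP=> /(allP a2); lia.
- by rewrite /= big_cons big_cat weight_blocks weight_swapped /=; lia.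
Qed.

Lemma fixed_wilf_seq_of s : wilf_seq n (fixed_wilf_of s).
Proof.
have := weight_room s s.
have [u1 a1] := blocks_unzip1 s s; have [u2 a2] := blocks_unzip2 s s => le_n.
rewrite /fixed_wilf_of; set X := _ - _ - _.
(* For odd [n] the pair [(3, 3)] contributes [9 = 1 + 2 * 4], hence the [4] taken off [n./2] in
   [X]. *)
have nX : n = 9 * odd n + 2 * X + 2 * weight s.
  by rewrite -{1}(odd_double_half n) /X; have := odd_double_half n; case: (odd n); lia.
have bigX : h.*2 * b + 4 <= X by move: nX; case: (odd n); lia.
have out1 k : ~~ (3 < k < h.*2 * b + 4) -> k \notin unzip1 (blocks s ++ swapped s).
  by apply: contra => /(allP a1).
have out2 k : ~~ (3 < k < h.*2 * b + 4) -> k \notin unzip2 (blocks s ++ swapped s).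
  by apply: contra => /(allP a2).
apply/and4P; split.
- rewrite all_cat all_nseq all_cat blocks_pos /=; lia.
- have oX : ~~ (3 < X < h.*2 * b + 4) by lia.
  rewrite /unzip1 map_cat [map _ ([:: _; _] ++ _)]map_cat -/(unzip1 _).
  case: (odd n); rewrite /= ?inE u1 !negb_or ?(out1 3 isT) (out1 1 isT) (out1 _ oX); lia.
- have oX : ~~ (3 < X < h.*2 * b + 4) by lia.
  rewrite /unzip2 map_cat [map _ ([:: _; _] ++ _)]map_cat -/(unzip2 _).
  case: (odd n); rewrite /= ?inE u2 !negb_or ?(out2 3 isT) (out2 1 isT) (out2 _ oX); lia.
- rewrite !big_cat weight_blocks weight_swapped !big_cons big_nil /=.
  by move: nX; case: (odd n); rewrite /= ?big_cons big_nil /=; lia.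
Qed.

Lemma fixed_wilf_of_swap s :
  {in fixed_wilf_of s, forall z, (z.2, z.1) \in fixed_wilf_of s}.
Proof.
move=> z; rewrite /fixed_wilf_of; set X := _ - _ - _.
rewrite !mem_cat !inE !mem_nseq => /or3P[/andP[-> /eqP->]//|/orP[] /eqP->|].
- by rewrite eqxx !orbT.
- by rewrite eqxx !orbT.
- by case/orP=> /mapP[u _ ->] /=; rewrite (mem_swapped, mem_blocks) !orbT.
Qed.

Lemma high_family_inj (s1 s2 : {ffun 'I_h -> {perm 'I_b}}) :
  (forall u, high s1 u = high s2 u) -> s1 = s2.
Proof.
move=> eqh; apply/ffunP=> i; apply/permP=> j; apply: val_inj.
by have := eqh (i, j); rewrite /high /= => /addnI.
Qed.

(** The multiplicity of the part [low u] reveals the first family, and the part of multiplicity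
    [low u] reveals the second. *)
Lemma wilf_of_inj : injective (fun st => pair_set n (wilf_of st)).
Proof.
move=> [s1 t1] [s2 t2] /pair_set_inj sub.
have {}sub := sub (wilf_seq_of _) (wilf_seq_of _).
case/and4P: (wilf_seq_of (s2, t2)) => _ u1 u2 _.
congr (_, _); apply: high_family_inj => u.
- have in1 : (low u, high s1 u) \in wilf_of (s2, t2).
    by apply: sub; rewrite inE mem_cat mem_blocks orbT.
  have in2 : (low u, high s2 u) \in wilf_of (s2, t2).
    by rewrite inE mem_cat mem_blocks orbT.
  exact (congr1 (@snd nat nat) (unzip1_inj_in u1 in1 in2 erefl)).
- have in1 : (high t1 u, low u) \in wilf_of (s2, t2).
    by apply: sub; rewrite inE mem_cat mem_swapped !orbT.
  have in2 : (high t2 u, low u) \in wilf_of (s2, t2).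
    by rewrite inE mem_cat mem_swapped !orbT.
  exact (congr1 (@fst nat nat) (unzip2_inj_in u2 in1 in2 erefl)).
Qed.

Lemma fixed_wilf_of_inj : injective (fun s => pair_set n (fixed_wilf_of s)).
Proof.
move=> s1 s2 /pair_set_inj sub.
have {}sub := sub (fixed_wilf_seq_of _) (fixed_wilf_seq_of _).
case/and4P: (fixed_wilf_seq_of s2) => _ u1 _ _; apply: high_family_inj => u.
have in1 : (low u, high s1 u) \in fixed_wilf_of s2.
  by apply: sub; rewrite !mem_cat mem_blocks !orbT.
have in2 : (low u, high s2 u) \in fixed_wilf_of s2.
  by rewrite !mem_cat mem_blocks !orbT.
exact (congr1 (@snd nat nat) (unzip1_inj_in u1 in1 in2 erefl)).
Qed.

Lemma wilf_count_ge : (b`! ^ h) ^ 2 <= wilf_count n.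
Proof.
have -> : (b`! ^ h) ^ 2
    = #|{: {ffun 'I_h -> {perm 'I_b}} * {ffun 'I_h -> {perm 'I_b}}}|.
  by rewrite card_prod card_ffun card_Sn card_ord.
rewrite -cardsT -(card_imset _ wilf_of_inj); apply: subset_leq_card.
by apply/subsetP=> _ /imsetP[st _ ->]; rewrite inE pair_set_wilf ?wilf_seq_of.
Qed.

Lemma wilf_fixed_count_ge : b`! ^ h <= wilf_fixed_count n.
Proof.
have -> : b`! ^ h = #|{: {ffun 'I_h -> {perm 'I_b}}}|.
  by rewrite card_ffun card_Sn card_ord.
rewrite -cardsT -(card_imset _ fixed_wilf_of_inj); apply: subset_leq_card.
apply/subsetP=> _ /imsetP[s _ ->]; rewrite inE pair_set_wilf ?fixed_wilf_seq_of //.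
exact/pair_set_fixed/fixed_wilf_of_swap.
Qed.

End Blocks.

(** * Upper bounds *)

Local Open Scope R_scope.

Lemma exp_le a b : a <= b -> exp a <= exp b.
Proof. by case=> [/exp_increasing|->]; lra. Qed.

Lemma rsum_le (I : finType) (P : pred I) (F G : I -> R) :
  (forall i, P i -> F i <= G i) -> \big[Rplus/0]_(i | P i) F i <= \big[Rplus/0]_(i | P i) G i.
Proof.
move=> leFG; elim/big_ind2: _ => //; first lra.
by move=> *; apply: Rplus_le_compat.
Qed.

Lemma rsum_mulr (I : finType) (P : pred I) (F : I -> R) c :
  (\big[Rplus/0]_(i | P i) F i) * c = \big[Rplus/0]_(i | P i) (F i * c).
Proof. exact: big_distrl. Qed.

Lemma rsum_const (I : finType) (P : pred I) c :
  \big[Rplus/0]_(i | P i) c = INR #|P| * c.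
Proof.
rewrite big_const; elim: #|P| => [|k IHk] /=; first lra.
by rewrite IHk -/(INR k.+1) S_INR; lra.
Qed.

Lemma rsum_nat (I : finType) (P : pred I) (F : I -> nat) :
  \big[Rplus/0]_(i | P i) INR (F i) = INR (\sum_(i | P i) F i).
Proof. by rewrite (big_morph INR plus_INR (erefl : INR 0 = 0)). Qed.

Lemma exp_rsum (I : finType) (P : pred I) (F : I -> R) :
  exp (\big[Rplus/0]_(i | P i) F i) = \big[Rmult/1]_(i | P i) exp (F i).
Proof. exact: (big_morph exp exp_plus exp_0). Qed.

(** Expanding the product of [1 + exp (a x)] over [U] gives one nonnegative term per subset, at
    least [exp c] for each member of [D]. The product is then bounded by [1 + v <= exp v]. *)
Lemma family_card_le (T : finType) (U : pred T) (D : {set {set T}}) (a : T -> R) c :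
  (forall S x, S \in D -> x \in S -> U x) ->
  (forall S, S \in D -> c <= \big[Rplus/0]_(x in S) a x) ->
  INR #|D| * exp c <= exp (\big[Rplus/0]_(x | U x) exp (a x)).
Proof.
move=> subU lec; pose e x := if U x then exp (a x) else 0.
have e0 x : 0 <= e x by rewrite /e; case: (U x); [have := exp_pos (a x); lra | lra].
have prod0 (J : {set T}) : 0 <= \big[Rmult/1]_x (if x \in J then e x else 1).
  by elim/big_ind: _ => [|*|x _]; [lra | apply: Rmult_le_pos | case: ifP => _; [|lra]].
apply: (@Rle_trans _ (\big[Rmult/1]_x (e x + 1))); last first.
  rewrite [\big[Rplus/0]_(x | _) _]big_mkcond exp_rsum.
  have: 0 <= \big[Rmult/1]_x (e x + 1) <= \big[Rmult/1]_x exp (e x).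
    elim/big_ind2: _ => [|r1 r2 r3 r4 [? ?] [? ?]|x _]; first lra.
      by split; [apply: Rmult_le_pos | apply: Rmult_le_compat].
    by have := e0 x; have := exp_ineq1_le (e x); lra.
  by case.
rewrite bigA_distr (bigID (mem D)) /= -[X in X <= _]Rplus_0_r.
apply: Rplus_le_compat; last first.
  by elim/big_ind: _ => [|*|J _]; [lra | lra | exact: prod0].
rewrite -(rsum_const (mem D)); apply: rsum_le => S SD.
apply: (@Rle_trans _ (exp (\big[Rplus/0]_(x in S) a x))).
  exact/exp_le/lec.
rewrite exp_rsum big_mkcond /=; apply: Req_le; apply: eq_bigr => x _.
by case: ifP => // /(subU _ _ SD) Ux; rewrite /e Ux.
Qed.

Lemma geometric_le (n : nat) u : 0 < u ->
  \big[Rplus/0]_(m : 'I_n.+1 | (0 < m)%N) exp (- (u * INR m)) <= / u.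
Proof.
move=> u0; rewrite big_mkcond /=.
pose s k := \big[Rplus/0]_(m < k.+1) (if (0 < m)%N then exp (- (u * INR m)) else 0).
(* Keeping the tail of the series makes the bound inductive; the step is [1 + u <= exp u]. *)
suff le1 : s n * u <= 1 - exp (- (u * INR n)).
  have := exp_pos (- (u * INR n)) => epos.
  apply: (Rmult_le_reg_r u) => //; rewrite Rinv_l; last lra.
  by apply: Rle_trans le1 _; lra.
elim: n => [|n IHn].
  by rewrite /s big_ord_recr big_ord0 /= Rmult_0_r Ropp_0 exp_0; lra.
have -> : s n.+1 = s n + exp (- (u * INR n.+1)) by rewrite /s big_ord_recr.
move: IHn; rewrite Rmult_plus_distr_r S_INR.
have -> : - (u * INR n) = - (u * (INR n + 1)) + u by ring.
rewrite exp_plus; move: (exp_pos (- (u * (INR n + 1)))).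
move: (exp _) => E E0.
have := exp_ineq1_le u.
nra.
Qed.

Lemma harmonic_le (n : nat) : (0 < n)%N ->
  \big[Rplus/0]_(p : 'I_n.+1 | (0 < p)%N) (/ INR p) <= 1 + ln (INR n).
Proof.
rewrite big_mkcond /=.
pose s k := \big[Rplus/0]_(p < k.+1) (if (0 < p)%N then / INR p else 0).
rewrite -/(s n); case: n => // n _; elim: n => [|n IHn].
  rewrite /s big_ord_recr big_ord_recr big_ord0 /= ln_1; lra.
have -> : s n.+2 = s n.+1 + / INR n.+2 by rewrite /s big_ord_recr.
have p1 : 0 < INR n.+1 by apply: lt_0_INR; lia.
have p2 : 0 < INR n.+2 by apply: lt_0_INR; lia.
(* This is [ln x <= x - 1] at [x = INR n.+1 / INR n.+2]. *)
suff: ln (INR n.+1) - ln (INR n.+2) <= - / INR n.+2 by lra.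
rewrite -ln_div //.
have -> : - / INR n.+2 = INR n.+1 / INR n.+2 - 1.
  by move: p2; rewrite (S_INR n.+1) => p2; field; lra.
have : 0 < INR n.+1 / INR n.+2 by apply: Rdiv_lt_0_compat.
move: (_ / _) => x x0.
have := exp_ineq1_le (ln x); rewrite exp_ln //; lra.
Qed.

(** * Exponential upper bounds for both counts *)

Section UpperBound.
Variable n : nat.
Hypothesis n0 : (0 < n)%N.

Let N := INR n.
Let w := Rpower N (1 / 3).
Let y := Rpower (6 * N) (1 / 3).
Let L := 1 + ln N.
Let pos (x : pm n) := ((0 < x.1) && (0 < x.2))%N.
Let prod (x : pm n) := INR (x.1 * x.2).

Lemma N_ge1 : 1 <= N.
Proof. by have := le_INR 1 n; rewrite -/N /=; apply; apply/leP. Qed.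

Lemma cube_w : w ^ 3 = N.
Proof.
have := N_ge1 => N1.
rewrite /w -Rpower_pow; last exact: exp_pos.
by rewrite Rpower_mult (_ : 1 / 3 * INR 3 = 1) ?Rpower_1 //=; [lra | field].
Qed.

Lemma cube_y : y ^ 3 = 6 * N.
Proof.
have := N_ge1 => N1.
rewrite /y -Rpower_pow; last exact: exp_pos.
by rewrite Rpower_mult (_ : 1 / 3 * INR 3 = 1) ?Rpower_1 //=; [lra | field].
Qed.

Lemma w_gt0 : 0 < w. Proof. exact: exp_pos. Qed.

Lemma w_ge1 : 1 <= w.
Proof. have := w_gt0; have := cube_w; have := N_ge1; move=> ? ? ?; nra. Qed.

Lemma L_ge1 : 1 <= L.
Proof.
rewrite /L; case: N_ge1 => [lt1|<-]; last by rewrite ln_1; lra.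
by have := ln_increasing 1 N; rewrite ln_1; lra.
Qed.

Lemma lnwL_ge0 : 0 <= ln (w * L).
Proof.
have := w_ge1; have := L_ge1 => ? ?.
rewrite -ln_1; apply: ln_le; nra.
Qed.

Lemma wilf_card_le (S : {set pm n}) : is_wilf S -> INR #|S| <= y.
Proof.
move=> /wilf_cube_card_le/leP/le_INR; rewrite (mult_INR 6 n) (_ : INR 6 = 6); last by simpl; lra.
rewrite -/N -cube_y.
have -> : INR (#|S| ^ 3) = INR #|S| ^ 3.
  by rewrite !expnS expn0 !mult_INR /=; ring.
have y0 : 0 < y by exact: exp_pos.
have := pos_INR #|S|; move: (INR _) => k k0 le3.
apply: Rnot_lt_le => lt_yk.
have : y ^ 3 < k ^ 3; last lra.
have : y * y < k * k by nra.
move=> ?; rewrite /= !Rmult_1_r; nra.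
Qed.

(** For fixed [p] the geometric sum over [m] is at most [w ^ 2 / p]. The harmonic sum over [p] then
    gives [w ^ 2 * L], and the prefactor [/ (w * L)] leaves [w]. *)
Lemma sum_exp_prod_le :
  \big[Rplus/0]_(x | pos x) exp (- ln (w * L) - prod x / w ^ 2) <= w.
Proof.
have w1 := w_ge1; have L1 := L_ge1.
have wL0 : 0 < w * L by nra.
have -> : \big[Rplus/0]_(x | pos x) exp (- ln (w * L) - prod x / w ^ 2)
    = / (w * L) * \big[Rplus/0]_(p : 'I_n.+1 | (0 < p)%N)
        \big[Rplus/0]_(m : 'I_n.+1 | (0 < m)%N) exp (- (INR p / w ^ 2 * INR m)).
  rewrite pair_big big_distrr /=; apply: eq_bigr => -[p m] _ /=.
  rewrite /prod /= mult_INR exp_plus exp_Ropp exp_ln //.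
  by congr (_ * exp _); field; lra.
apply: (@Rle_trans _ (/ (w * L) * (w ^ 2 * L))); last by apply: Req_le; field; lra.
apply: Rmult_le_compat_l; first by apply: Rlt_le; apply: Rinv_0_lt_compat.
have w20 : 0 < w ^ 2 by apply: pow_lt; lra.
apply: (@Rle_trans _ (\big[Rplus/0]_(p : 'I_n.+1 | (0 < p)%N) (/ INR p * w ^ 2))).
  apply: rsum_le => p p0; have Np0 : 0 < INR p by apply: lt_0_INR; apply/ltP.
  apply: Rle_trans (geometric_le _ _) _; first exact: Rdiv_lt_0_compat.
  by apply: Req_le; field; lra.
rewrite -rsum_mulr Rmult_comm; apply: Rmult_le_compat_l; first lra.
exact: harmonic_le.
Qed.

(** This controls the diagonal pairs [(p, p)] of fixed points, which are not doubled by the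
    symmetry. *)
Lemma sum_exp_sqr_le :
  \big[Rplus/0]_(p : 'I_n.+1 | (0 < p)%N) exp (- (INR p ^ 2 / w ^ 2)) <= 2 * w.
Proof.
have w1 := w_ge1.
apply: (@Rle_trans _ (\big[Rplus/0]_(p : 'I_n.+1 | (0 < p)%N)
    (exp (- (2 / w * INR p)) * exp 1))).
  (* The tangent line of the square at [w] reduces the sum to a geometric one. *)
  apply: rsum_le => p _; rewrite -exp_plus; apply: exp_le.
  have : 0 <= (INR p / w - 1) ^ 2 by apply: pow2_ge_0.
  suff -> : (INR p / w - 1) ^ 2 = INR p ^ 2 / w ^ 2 - 2 / w * INR p + 1 by lra.
  by field; lra.
rewrite -rsum_mulr.
apply: (@Rle_trans _ (/ (2 / w) * 3)).
  apply: Rmult_le_compat; last exact: exp_le_3.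
  - by elim/big_ind: _ => [|*|p _]; [lra | lra | apply/Rlt_le/exp_pos].
  - exact/Rlt_le/exp_pos.
  - by apply: geometric_le; apply: Rdiv_lt_0_compat; lra.
by rewrite (_ : / (2 / w) = w / 2); [lra | field; lra].
Qed.

Lemma w_eq : N / w ^ 2 = w.
Proof. have := w_gt0; rewrite -cube_w => ?; field; lra. Qed.

Lemma wilf_count_le : INR (wilf_count n) <= exp (y * ln (w * L) + 2 * w).
Proof.
(* A lower bound for the exponent of every Wilf partition: at most [y] pairs, and
   [N / w ^ 2 = w]. *)
pose c := - (y * ln (w * L)) - w.
suff : INR (wilf_count n) * exp c <= exp w.
  move=> /(Rmult_le_compat_r _ _ _ (Rlt_le _ _ (exp_pos (- c)))).
  rewrite Rmult_assoc -!exp_plus Rplus_opp_r exp_0 Rmult_1_r.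
  by rewrite (_ : w + - c = y * ln (w * L) + 2 * w); [|rewrite /c; ring].
apply: Rle_trans (_ : exp (\big[Rplus/0]_(x | pos x)
    exp (- ln (w * L) - prod x / w ^ 2)) <= _); last exact/exp_le/sum_exp_prod_le.
apply: family_card_le => [S x|S]; rewrite inE.
  by case/wilfP=> S0 _ _ _ /S0[x1 x2]; rewrite /pos x1 x2.
move=> wS; have card_le := wilf_card_le wS; case/wilfP: wS => _ _ _ sumS.
have sumN : \big[Rplus/0]_(x in S) prod x = N by rewrite rsum_nat sumS.
have sum1 : \big[Rplus/0]_(x in S) 1 = INR #|S| by rewrite rsum_const Rmult_1_r.
have -> : \big[Rplus/0]_(x in S) (- ln (w * L) - prod x / w ^ 2)
    = - (INR #|S| * ln (w * L)) - N / w ^ 2.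
  rewrite -sum1 -sumN; move: (ln _) => l.
  rewrite /Rdiv !rsum_mulr /Rminus !(big_morph Ropp Ropp_plus_distr Ropp_0) -big_split.
  by apply: eq_bigr => x _ /=; rewrite Rmult_1_l.
rewrite w_eq.
have := lnwL_ge0; rewrite /c; move: (ln _) => l ?; nra.
Qed.

Lemma wilf_fixed_count_le :
  INR (wilf_fixed_count n) <= exp (y / 2 * ln (w * L) + 4 * w).
Proof.
pose c := - (y / 2 * ln (w * L)) - w.
suff : INR (wilf_fixed_count n) * exp c <= exp (3 * w).
  move=> /(Rmult_le_compat_r _ _ _ (Rlt_le _ _ (exp_pos (- c)))).
  rewrite Rmult_assoc -!exp_plus Rplus_opp_r exp_0 Rmult_1_r.
  by rewrite (_ : 3 * w + - c = y / 2 * ln (w * L) + 4 * w); [|rewrite /c; field].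
pose upper (S : {set pm n}) := [set x in S | (x.1 <= x.2)%N].
pose mult (x : pm n) := if x.1 == x.2 then 1%N else 2%N.
(* An off-diagonal pair stands for two, so half the logarithm per pair already gives it the full
   factor [/ (w * L)]. *)
pose a x := INR (mult x) * (- (ln (w * L) / 2) - prod x / w ^ 2).
have -> : wilf_fixed_count n
    = #|[set upper S | S in [set S : {set pm n} | is_wilf S && iota_fixed S]]|.
  rewrite card_in_imset // => S1 S2; rewrite !inE => /andP[_ f1] /andP[_ f2].
  exact: fixed_upper_inj.
apply: Rle_trans (_ : exp (\big[Rplus/0]_(x | pos x) exp (a x)) <= _).
  apply: family_card_le => [_ x /imsetP[S + ->]|_ /imsetP[S + ->]]; rewrite inE.
    by case/andP=> /wilfP[S0 _ _ _] _; rewrite inE => /andP[/S0[x1 x2] _]; rewrite /pos x1 x2.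
  case/andP=> wS fS; have card_le := wilf_card_le wS; case/wilfP: wS => _ _ _ sumS.
  have sumN : \big[Rplus/0]_(x in upper S) INR (mult x * (x.1 * x.2)) = N.
    rewrite rsum_nat /N -[in RHS]sumS.
    rewrite (sum_fixed (g := fun x => (x.1 * x.2)%N) fS) => [|x]; last exact: mulnC.
    by congr INR; apply: eq_bigl => x; rewrite inE.
  have sum1 : \big[Rplus/0]_(x in upper S) INR (mult x) = INR #|S|.
    rewrite rsum_nat -sum1_card (sum_fixed (g := fun=> 1%N) fS) //.
    by congr INR; apply: eq_big => x; rewrite ?inE // muln1.
  have -> : \big[Rplus/0]_(x in upper S) a x
      = - (INR #|S| * (ln (w * L) / 2)) - N / w ^ 2.
    rewrite -sum1 -sumN /a; move: (ln _ / 2) => l.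
    rewrite /Rdiv !rsum_mulr /Rminus !(big_morph Ropp Ropp_plus_distr Ropp_0) -big_split.
    apply: eq_bigr => x _ /=; rewrite mult_INR /prod.
    by move: (INR (mult x)) (INR (x.1 * x.2)) (/ _) => *; ring.
  rewrite w_eq.
  have := lnwL_ge0; rewrite /c; move: (ln _) => l ?; nra.
apply: exp_le.
have -> : 3 * w = w + 2 * w by ring.
apply: Rle_trans (Rplus_le_compat _ _ _ _ sum_exp_prod_le sum_exp_sqr_le).
have -> : \big[Rplus/0]_(p : 'I_n.+1 | (0 < p)%N) exp (- (INR p ^ 2 / w ^ 2))
    = \big[Rplus/0]_(x | pos x)
        (if x.1 == x.2 then exp (- (prod x / w ^ 2)) else 0).
  rewrite /pos -(pair_big (fun p : 'I_n.+1 => 0 < p)%N (fun m : 'I_n.+1 => 0 < m)%N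
    (fun p m => if p == m then exp (- (INR (p * m) / w ^ 2)) else 0)) /=.
  apply: eq_bigr => p p0; rewrite (bigD1 p) //= eqxx big1 ?Rplus_0_r => [|m].
    by rewrite mult_INR /= Rmult_1_r.
  by case/andP=> _; rewrite eq_sym => /negbTE->.
(* Termwise: on the diagonal the logarithm is dropped, off the diagonal one of the two copies of
   [prod x / w ^ 2]. *)
rewrite -big_split; apply: rsum_le => x _ /=.
rewrite /a /mult; have l0 := lnwL_ge0; have w0 := w_gt0.
have v0 : 0 <= prod x / w ^ 2.
  by apply: Rmult_le_pos; [apply: pos_INR | apply/Rlt_le/Rinv_0_lt_compat/pow_lt].
move: (prod x / w ^ 2) v0 => v v0; case: eqP => _; rewrite [INR _]/=.
  rewrite -[X in X <= _]Rplus_0_l; apply: Rplus_le_compat; first exact/Rlt_le/exp_pos.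
  by apply: exp_le; lra.
by rewrite Rplus_0_r; apply: exp_le; lra.
Qed.

End UpperBound.

(** * Asymptotics *)

Section Asymptotics.

Let g n := 1 / 6 * Rpower (6 * INR n) (1 / 3) * ln (INR n).

Lemma INR_expn a k : INR (expn a k) = INR a ^ k.
Proof. by elim: k => // k IHk; rewrite expnS mult_INR IHk. Qed.

(** A weak Stirling bound; the induction step is [b * ln (1 + 1 / b) <= 1]. *)
Lemma ln_fact_ge b : (0 < b)%N -> INR b * (ln (INR b) - 1) <= ln (INR b`!).
Proof.
case: b => // b _; elim: b => [|b IHb]; first by rewrite /= ln_1; lra.
have p1 : 0 < INR b.+1 by apply: lt_0_INR; lia.
have p2 : 0 < INR b.+2 by apply: lt_0_INR; lia.
have pf : 0 < INR (b.+1)`! by apply: lt_0_INR; apply/ltP/fact_gt0.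
rewrite factS mult_INR ln_mult //.
suff : INR b.+1 * (ln (INR b.+2) - ln (INR b.+1)) <= 1.
  by move: IHb; rewrite (S_INR b.+1); nra.
rewrite -ln_div // (S_INR b.+1).
have -> : (INR b.+1 + 1) / INR b.+1 = 1 + / INR b.+1 by field; lra.
have i0 := Rinv_0_lt_compat _ p1.
have := exp_ineq1_le (ln (1 + / INR b.+1)); rewrite exp_ln; last lra.
move=> le; have : INR b.+1 * ln (1 + / INR b.+1) <= INR b.+1 * / INR b.+1.
  by apply: Rmult_le_compat_l; lra.
by rewrite Rinv_r; lra.
Qed.

(** Since [ln w = ln n / 3], the term [y / 2 * ln w] is exactly [g n]. What remains is at most
    [y * (ln L / 2 + 4)], of smaller order. *)
Lemma log_counts_le eps : 0 < eps -> exists C, forall n, (0 < n)%N -> C <= ln (INR n) ->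
  0 < INR (wilf_fixed_count n) -> 0 < INR (wilf_count n) ->
  ln (INR (wilf_fixed_count n)) <= (1 + eps) * g n /\
  1 / 2 * ln (INR (wilf_count n)) <= (1 + eps) * g n.
Proof.
move=> e0; pose k := eps / 6; have k0 : 0 < k by rewrite /k; lra.
exists (Rmax 0 (12 / eps * (1 / 2 * (k - 1 - ln k) + 4))) => n n0 leC F0 f0.
have N1 := N_ge1 n0; have y3 := cube_y n0; have w3 := cube_w n0.
have L1 := L_ge1 n0.
have := wilf_count_le n0; have := wilf_fixed_count_le n0.
rewrite /g; move: y3 w3.
have : 0 < Rpower (6 * INR n) (1 / 3) by exact: exp_pos.
have : 0 < Rpower (INR n) (1 / 3) by exact: exp_pos.
have lnw : ln (Rpower (INR n) (1 / 3)) = ln (INR n) / 3.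
  by rewrite /Rpower ln_exp; field.
move: lnw; move: (Rpower (INR n) _) (Rpower (6 * _) _) => w y lnw w0 y0 y3 w3 leF lef.
move: L1 leC leF lef; move: (ln (INR n)) lnw => l lnw L1 leC leF lef.
have wy : w <= y.
  apply: Rnot_lt_le => lt; have : y * y < w * w by nra.
  by move: y3 w3 => /=; nra.
(* A tangent line of slope [k] to the logarithm; it contributes [eps / 12 * l] to [small], and the
   threshold on [l] absorbs the constants in another [eps / 12 * l]. *)
have leL : ln (1 + l) <= k * (1 + l) - 1 - ln k.
  have := exp_ineq1_le (ln (k * (1 + l))); rewrite exp_ln; last nra.
  by rewrite ln_mult; lra.
have l0 : 0 <= l by have := Rmax_l 0 (12 / eps * (1 / 2 * (k - 1 - ln k) + 4)); lra.
have small : 1 / 2 * ln (1 + l) + 4 <= eps / 6 * l.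
  have : 12 / eps * (1 / 2 * (k - 1 - ln k) + 4) <= l.
    by apply: Rle_trans leC; apply: Rmax_r.
  move/(Rmult_le_compat_l (eps / 12) _ _ ltac:(lra)).
  rewrite -Rmult_assoc (_ : eps / 12 * (12 / eps) = 1); last by field; lra.
  by move: leL; rewrite /k; nra.
have main : y / 2 * ln (w * (1 + l)) + 4 * w <= (1 + eps) * (1 / 6 * y * l).
  rewrite ln_mult ?lnw; [|lra|lra].
  have : y * (1 / 2 * ln (1 + l) + 4) <= y * (eps / 6 * l).
    by apply: Rmult_le_compat_l; lra.
  by move: (ln (1 + l)) => q; nra.
split.
  by move/(ln_le _ _ F0): leF; rewrite ln_exp; lra.
by move/(ln_le _ _ f0): lef; rewrite ln_exp; lra.
Qed.

(** A factor [1 - d] is lost three times: in [2 h / (2 h + 5)], in rounding [b] down, and in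
    [ln b - 1] against [ln n / 3]. With [d = eps / 3], [(1 - d) ^ 3 >= 1 - eps]. *)
Lemma log_counts_ge eps : 0 < eps < 1 -> exists C, forall n, (0 < n)%N -> C <= ln (INR n) ->
  [/\ 0 < INR (wilf_fixed_count n), 0 < INR (wilf_count n),
      (1 - eps) * g n <= ln (INR (wilf_fixed_count n)) &
      (1 - eps) * g n <= 1 / 2 * ln (INR (wilf_count n))].
Proof.
move=> [e0 e1]; pose d := eps / 3; have d0 : 0 < d < 1 / 3 by rewrite /d; lra.
have [h hd] : exists h, 5 / d < INR h.
  have := proj2 (is_lim_seq_spec _ _) is_lim_seq_INR (5 / d).
  by case=> h0 /(_ h0 (le_n _)) lt; exists h0.
have h0 : 0 < INR h by apply: Rlt_trans hd; apply: Rdiv_lt_0_compat; lra.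
pose c := / (2 * INR h + 5).
have c0 : 0 < c by apply: Rinv_0_lt_compat; lra.
have hc : 1 - d <= 2 * INR h * c.
  rewrite /c; have : 5 < INR h * d.
    by move/(Rmult_lt_compat_r d _ _ (proj1 d0)): hd; rewrite /Rdiv Rmult_assoc Rinv_l; lra.
  move=> ?; apply: (Rmult_le_reg_r (2 * INR h + 5)); first lra.
  rewrite Rmult_assoc Rinv_l; nra.
(* [C1] makes the rounding loss at most the fraction [d], [C2] ensures [b >= 8], and [C3] absorbs
   the constants in [ln b - 1]. *)
pose C1 := 3 / (d * c); pose C2 := 27 / c; pose C3 := 3 * (1 - ln ((1 - d) * c)) / d.
exists (Rmax C1 (Rmax C2 C3)) => n n0 leC.
have {leC} [leC1 leC2 leC3] : [/\ C1 <= ln (INR n), C2 <= ln (INR n) & C3 <= ln (INR n)].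
  have := Rmax_l C1 (Rmax C2 C3); have := Rmax_r C1 (Rmax C2 C3).
  by have := Rmax_l C2 C3; have := Rmax_r C2 C3; split; lra.
have N1 := N_ge1 n0; have y3 := cube_y n0; rewrite /g; move: y3.
have : ln (INR n) / 3 <= ln (Rpower (6 * INR n) (1 / 3)).
  rewrite /Rpower ln_exp ln_mult; [|lra|lra].
  by have := ln_le 1 6; rewrite ln_1; lra.
have : 0 < Rpower (6 * INR n) (1 / 3) by exact: exp_pos.
move: (Rpower _ _) => y y0 ly y3.
move: leC1 leC2 leC3 ly; set l := ln (INR n) => leC1 leC2 leC3 ly.
have ley : l / 3 <= y by have := exp_ineq1_le (ln y); rewrite exp_ln; lra.
(* The largest [b] with [b * (2 h + 5) <= y], which is the hypothesis [room] of the construction. *)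
have [b [leb ltb]] : exists b, INR b <= c * y < INR b + 1.
  by have [b] := nfloor_ex (c * y) ltac:(nra); exists b.
have y1 : 1 <= d * (c * y).
  have /(Rmult_le_compat_l (d * c) _ _ ltac:(nra)) : 3 / (d * c) <= 3 * y by rewrite -/C1; lra.
  by rewrite (_ : d * c * (3 / (d * c)) = 3); [nra | field; lra].
have y2 : 9 <= c * y.
  have /(Rmult_le_compat_l c _ _ ltac:(lra)) : 27 / c <= 3 * y by rewrite -/C2; lra.
  by rewrite (_ : c * (27 / c) = 27); [nra | field; lra].
have b8 : (8 <= b)%N.
  suff : (7 < b)%coq_nat by lia.
  by apply: INR_lt; simpl; lra.
have geb : (1 - d) * c * y <= INR b by nra.
have lnb : (1 - d) * l / 3 <= ln (INR b) - 1.
  have dc0 : 0 < (1 - d) * c by nra.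
  have : ln ((1 - d) * c * y) <= ln (INR b) by apply: ln_le => //; nra.
  rewrite ln_mult //.
  have : d * C3 <= d * l by apply: Rmult_le_compat_l; lra.
  by rewrite /C3 (_ : d * (3 * (1 - ln ((1 - d) * c)) / d) = 3 * (1 - ln ((1 - d) * c)));
    [lra | field; lra].
have room : ((b * (h.*2 + 5)) ^ 3 <= 6 * n)%N.
  apply/leP/INR_le; rewrite INR_expn (mult_INR 6) (_ : INR 6 = 6); last by simpl; lra.
  rewrite -y3; apply: pow_incr; split; first exact: pos_INR.
  rewrite -mul2n mult_INR plus_INR mult_INR.
  have -> : INR 2 * INR h + INR 5 = / c by rewrite /c Rinv_inv; simpl; lra.
  apply: (Rmult_le_reg_l c) => //.
  by rewrite (_ : c * (INR b * / c) = INR b); [lra | field; lra].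
have l0 : 0 <= l.
  by apply: Rle_trans leC2; apply/Rlt_le/Rdiv_lt_0_compat; lra.
have fact0 : 0 < INR b`! by apply: lt_0_INR; apply/ltP/fact_gt0.
have log_fact : (1 - eps) * (1 / 6 * y * l) <= INR h * ln (INR b`!).
  apply: (@Rle_trans _ (INR h * (((1 - d) * c * y) * ((1 - d) * l / 3)))); last first.
    apply: Rmult_le_compat_l; first lra.
    apply: Rle_trans (ln_fact_ge _); last by lia.
    by apply: Rmult_le_compat => //; nra.
  have -> : INR h * ((1 - d) * c * y * ((1 - d) * l / 3))
      = (2 * INR h * c) * ((1 - d) * (1 - d)) * (1 / 6 * y * l) by field.
  apply: Rmult_le_compat_r; first by nra.
  apply: (@Rle_trans _ ((1 - d) * ((1 - d) * (1 - d)))); last by apply: Rmult_le_compat_r; nra.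
  by rewrite (_ : eps = 3 * d); [nra | rewrite /d; field].
have pw0 : 0 < INR b`! ^ h by apply: pow_lt.
have leF : INR b`! ^ h <= INR (wilf_fixed_count n).
  by rewrite -INR_expn; apply/le_INR/leP/wilf_fixed_count_ge.
have lef : (INR b`! ^ h) ^ 2 <= INR (wilf_count n).
  by rewrite -!INR_expn; apply/le_INR/leP/wilf_count_ge.
have pw20 : 0 < (INR b`! ^ h) ^ 2 by apply: pow_lt.
split; [lra | lra | |].
- by move/(ln_le _ _ pw0): leF; rewrite ln_pow //; lra.
- by move/(ln_le _ _ pw20): lef; rewrite ln_pow // ln_pow //=; lra.
Qed.

(** * Passage to the limit *)

Lemma eventually_ln_ge C : exists n0, forall n, (n0 <= n)%coq_nat ->
  (0 < n)%N /\ C <= ln (INR n).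
Proof.
have [n0 ltn0] := proj2 (is_lim_seq_spec _ _) is_lim_seq_INR (exp C).
exists n0 => n /ltn0 ltn; have e0 := exp_pos C; split.
  by apply/ltP/INR_lt; simpl; lra.
by rewrite -[C]ln_exp; apply: ln_le; lra.
Qed.

Lemma g_gt0 n : 1 <= ln (INR n) -> 0 < g n.
Proof.
by rewrite /g => l1; have : 0 < Rpower (6 * INR n) (1 / 3) by [exact: exp_pos]; nra.
Qed.

Lemma lim_ratio (u : nat -> R) :
  (forall eps, 0 < eps < 1 -> exists C, forall n, (0 < n)%N -> C <= ln (INR n) ->
     (1 - eps) * g n <= u n <= (1 + eps) * g n) ->
  is_lim_seq (fun n => u n / g n) 1.
Proof.
move=> bnd; apply/is_lim_seq_spec => eps.
(* Strictly below [eps], for the strict inequality in the limit, and below [1], as [bnd]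
   requires. *)
pose e := Rmin (eps / 2) (1 / 2).
have e0 : 0 < e < 1 by rewrite /e; have := cond_pos eps; rewrite /Rmin; case: Rle_dec; lra.
have lte : e < eps by have := Rmin_l (eps / 2) (1 / 2); have := cond_pos eps; rewrite /e; lra.
have [C leC] := bnd e e0.
have [n0 evn] := eventually_ln_ge (Rmax 1 C).
exists n0 => n /evn[n_gt0 leln].
have l1 : 1 <= ln (INR n) by apply: Rle_trans leln; apply: Rmax_l.
have [ge le] := leC n n_gt0 (Rle_trans _ _ _ (Rmax_r _ _) leln).
have g0 := g_gt0 l1.
apply/Rabs_def1; apply: (Rmult_lt_reg_r (g n)) => //.
- rewrite (_ : (u n / g n - 1) * g n = u n - g n); [nra | field; lra].
- rewrite (_ : (u n / g n - 1) * g n = u n - g n); [nra | field; lra].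
Qed.

Lemma log_count_bounds eps : 0 < eps < 1 ->
  exists C, forall n, (0 < n)%N -> C <= ln (INR n) ->
    (1 - eps) * g n <= ln (INR (wilf_fixed_count n)) <= (1 + eps) * g n /\
    (1 - eps) * g n <= 1 / 2 * ln (INR (wilf_count n)) <= (1 + eps) * g n.
Proof.
move=> e01; have [C1 ge] := log_counts_ge e01; have [C2 le] := log_counts_le (proj1 e01).
exists (Rmax C1 C2) => n n0 leC.
have [F0 f0 geF gef] := ge n n0 (Rle_trans _ _ _ (Rmax_l _ _) leC).
by have [leF lef] := le n n0 (Rle_trans _ _ _ (Rmax_r _ _) leC) F0 f0.
Qed.

Lemma lim_log_fixed : is_lim_seq (fun n => ln (INR (wilf_fixed_count n)) / g n) 1.
Proof.
apply: lim_ratio => eps /log_count_bounds[C bnd].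
by exists C => n n0 leC; case: (bnd n n0 leC).
Qed.

Lemma lim_log_count : is_lim_seq (fun n => 1 / 2 * ln (INR (wilf_count n)) / g n) 1.
Proof.
apply: lim_ratio => eps /log_count_bounds[C bnd].
by exists C => n n0 leC; case: (bnd n n0 leC).
Qed.

Lemma lim_log_fixed_count :
  is_lim_seq (fun n => ln (INR (wilf_fixed_count n)) / (1 / 2 * ln (INR (wilf_count n)))) 1.
Proof.
have lim := is_lim_seq_div' _ _ _ _ lim_log_fixed lim_log_count R1_neq_R0.
rewrite (_ : 1 = 1 / 1); last by field.
apply: is_lim_seq_ext_loc lim.
(* Cancelling [g n] in the quotient of the two limits needs [g n] and [ln (INR (wilf_count n))]
   nonzero; any fixed [eps] below [1] gives the latter. *)
have [C bnd] := @log_count_bounds (1 / 2) ltac:(lra).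
have [n0 evn] := eventually_ln_ge (Rmax 1 C).
exists n0 => n /evn[n_gt0 leln].
have g0 := g_gt0 (Rle_trans _ _ _ (Rmax_l _ _) leln).
have [_ [ge _]] := bnd n n_gt0 (Rle_trans _ _ _ (Rmax_r _ _) leln).
move: ge; move: (ln (INR (wilf_count n))) => f ge.
by field; split; lra.
Qed.

End Asymptotics.

Theorem theorem1 :
  is_lim_seq (fun n : nat =>
      ln (INR (wilf_fixed_count n)) / ((1/2) * ln (INR (wilf_count n)))) 1 /\
  is_lim_seq (fun n : nat =>
      ((1/2) * ln (INR (wilf_count n))) /
      ((1/6) * Rpower (6 * INR n) (1/3) * ln (INR n))) 1.
Proof. by split; [exact: lim_log_fixed_count | exact: lim_log_count]. Qed.
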